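(* Let $n\geq 2$ and $$\Omega:=\{ p=(x, y, \bar{p}) \in \mathbb{R}^2 \times \mathbb{R}^{n-2} \mid x^2+y^2 < 1 \}.$$ For $p=(x,y,\bar p)\in\Omega$ and a tangent vector $\mathbf{y}=(u,v,\bar{\mathbf y})\in T_p\Omega=\mathbb{R}^n=\mathbb{R}^2\times\mathbb{R}^{n-2}$ define $$F(\mathbf{y}) := \frac{\sqrt{ ( -y u + x v )^2 + |\mathbf{y}|^2 ( 1- x^2 -y^2 ) } - ( - yu + x v ) }{ 1- x^2 - y^2 },$$ where $|\cdot|$ is the standard Euclidean norm on $\mathbb{R}^n$. Then $F$ is a Finsler metric on $\Omega$ whose flag curvature and S-curvature satisfy $$\mathbf{K}=0,\qquad \mathbf{S}=0,$$ i.e. $\mathbf{K}(P,\mathbf{y})=0$ for every point $p\in\Omega$, every two-dimensional plane $P\subset T_p\Omega$ and every nonzero $\mathbf{y}\in P$, and $\mathbf{S}(\mathbf{y})=0$ for every nonzero tangent vector $\mathbf{y}$.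
   Context: A Finsler metric on a manifold $M$ is a function $F:TM\to[0,\infty)$, smooth on $TM\setminus\{0\}$, such that (a) $F(\lambda\mathbf{y})=\lambda F(\mathbf{y})$ for $\lambda>0$; (b) for every nonzero $\mathbf{y}\in T_xM$ the bilinear form $g_{\mathbf y}(\mathbf u,\mathbf v):=\frac12\frac{\partial^2}{\partial s\partial t}[F^2(\mathbf y+s\mathbf u+t\mathbf v)]|_{s=t=0}$ on $T_xM$ is an inner product. In local coordinates write $\mathbf y=y^i\frac{\partial}{\partial x^i}|_x$, $g_{ij}(x,y)=\frac12[F^2]_{y^iy^j}(x,y)$, $(g^{ij})=(g_{ij})^{-1}$. The geodesic coefficients of $F$ are $$G^i:=\tfrac14 g^{il}\Big\{2\frac{\partial g_{jl}}{\partial x^k}-\frac{\partial g_{jk}}{\partial x^l}\Big\}y^jy^k .$$ The Riemann curvature $\mathbf R_{\mathbf y}=R^i_{\ k}(x,y)\,dx^k\otimes\frac{\partial}{\partial x^i}:T_xM\to T_xM$ is $$R^i_{\ k}:=2\frac{\partial G^i}{\partial x^k}-y^j\frac{\partial^2G^i}{\partial x^j\partial y^k}+2G^j\frac{\partial^2G^i}{\partial y^j\partial y^k}-\frac{\partial G^i}{\partial y^j}\frac{\partial G^j}{\partial y^k}.$$ For a two-dimensional plane $P=\mathrm{span}\{\mathbf y,\mathbf u\}\subset T_xM$ with $\mathbf{y}\ne 0$, the flag curvature is $$\mathbf K(P,\mathbf y):=\frac{g_{\mathbf y}(\mathbf R_{\mathbf y}(\mathbf u),\mathbf u)}{g_{\mathbf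 y}(\mathbf y,\mathbf y)g_{\mathbf y}(\mathbf u,\mathbf u)-g_{\mathbf y}(\mathbf y,\mathbf u)^2}.$$ The (Busemann–Hausdorff) volume form is $dV_F=\sigma_F(x)\,dx^1\cdots dx^n$ with $$\sigma_F(x):=\frac{\mathrm{Vol}(\mathbb B^n(1))}{\mathrm{Vol}\{(y^i)\in\mathbb R^n\mid F(y^i\frac{\partial}{\partial x^i}|_x)<1\}},$$ where $\mathbb{B}^n(1)$ is the Euclidean unit ball and $\mathrm{Vol}$ is Euclidean volume. The S-curvature is $$\mathbf S(\mathbf y):=\frac{\partial G^i}{\partial y^i}(x,y)-y^i\frac{\partial}{\partial x^i}[\ln\sigma_F(x)].$$ Summation over repeated indices is understood. *)

(* Defs.v *)
From mathcomp Require Import all_boot all_order all_algebra.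
From mathcomp Require Import all_classical all_reals all_analysis.

Set Implicit Arguments.
Unset Strict Implicit.
Unset Printing Implicit Defensive.

Import Order.TTheory GRing.Theory Num.Theory.
Import numFieldNormedType.Exports.

Local Open Scope classical_set_scope.
Local Open Scope ring_scope.

(* The manifold is an open subset U of R^n = 'rV[R]_n with its global
   coordinates, and TU = U * R^n.  A function on TU is represented by a total
   function of the base point x and of the tangent vector y, whose values at
   x outside U are irrelevant. *)

Section Smooth.
Variables (R : realType) (V W : normedModType R).

(* On an open subset of a finite-dimensional space this is the class C^k: f is
   C^(k+1) iff it is continuous and all its directional derivatives exist and
   are C^k. *)
Fixpoint class_C (k : nat) (U : set V) (f : V -> W) : Prop :=
  (forall x, U x -> {for x, continuous f}) /\
  if k is k'.+1 then
    forall v, (forall x, U x -> derivable f x v) /\ class_C k' U ('D_v f)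
  else True.

Definition smooth_on (U : set V) (f : V -> W) : Prop :=
  forall k, class_C k U f.

End Smooth.

Section Euclidean.
Variables (R : realType) (n : nat).
Implicit Types (A : set 'rV[R]_n) (x y : 'rV[R]_n).

Definition coord_vec (i : 'I_n) : 'rV[R]_n := delta_mx 0 i.

(* The norm that MathComp-Analysis puts on 'rV[R]_n is the sup norm; it induces
   the usual topology, but the Euclidean norm has to be defined. *)
Definition enorm y : R := Num.sqrt (\sum_i y 0 i ^+ 2).

Definition box (ab : 'rV[R]_n * 'rV[R]_n) : set 'rV[R]_n :=
  [set x | forall i, ab.1 0 i < x 0 i <= ab.2 0 i].

Definition box_volume (ab : 'rV[R]_n * 'rV[R]_n) : R :=
  \prod_i (ab.2 0 i - ab.1 0 i).

(* n-dimensional Lebesgue (outer) measure: the infimum of the total volume of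
   the countable covers by half-open boxes.  It is only used on open sets. *)
Definition volume A : \bar R :=
  ereal_inf [set (\sum_(k <oo) (box_volume (B k))%:E)%E |
    B in [set B : nat -> 'rV[R]_n * 'rV[R]_n |
      (forall k i, (B k).1 0 i <= (B k).2 0 i) /\
      A `<=` \bigcup_k box (B k)]].

Definition inner_product (b : 'rV[R]_n -> 'rV[R]_n -> R) : Prop :=
  [/\ forall (a : R) u v w, b (a *: u + v) w = a * b u w + b v w,
      forall u v, b u v = b v u
    & forall u, u != 0 -> 0 < b u u].

End Euclidean.

Section Finsler.
Variables (R : realType) (n : nat).
Implicit Types (F f : 'rV[R]_n -> 'rV[R]_n -> R) (x y u v : 'rV[R]_n).

Definition fundamental_form F x y u v : R :=
  2^-1 * derive1 (fun s : R =>
    derive1 (fun t : R => F x (y + s *: u + t *: v) ^+ 2) 0) 0.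

Definition finsler_metric (U : set 'rV[R]_n) F : Prop :=
  [/\ open U,
      forall x y, U x -> 0 <= F x y,
      smooth_on (U `*` ~` [set 0]) (fun xy => F xy.1 xy.2),
      forall x y (lambda : R), U x -> 0 < lambda ->
        F x (lambda *: y) = lambda * F x y
    & forall x y, U x -> y != 0 -> inner_product (fundamental_form F x y)].

Definition partial_x (i : 'I_n) f x y : R :=
  'D_(coord_vec R i) (fun x' => f x' y) x.

Definition partial_y (i : 'I_n) f x y : R :=
  'D_(coord_vec R i) (f x) y.

Definition metric_tensor F x y : 'M[R]_n :=
  \matrix_(i, j)
    (2^-1 * partial_y j (partial_y i (fun x' y' => F x' y' ^+ 2)) x y).

Definition geodesic_coef F (i : 'I_n) x y : R :=
  let g (j l : 'I_n) := fun x' y' => metric_tensor F x' y' j l in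
  4^-1 * \sum_l \sum_j \sum_k
    invmx (metric_tensor F x y) i l *
    (2 * partial_x k (g j l) x y - partial_x l (g j k) x y) *
    y 0 j * y 0 k.

Definition riemann_coef F (i k : 'I_n) x y : R :=
  let G := geodesic_coef F in
  2 * partial_x k (G i) x y
  - \sum_j y 0 j * partial_x j (partial_y k (G i)) x y
  + 2 * (\sum_j G j x y * partial_y j (partial_y k (G i)) x y)
  - \sum_j partial_y j (G i) x y * partial_y k (G j) x y.

Definition riemann_curvature F x y u : 'rV[R]_n :=
  \row_i \sum_k riemann_coef F i k x y * u 0 k.

(* The flag curvature K(P, y) at x of the plane P = span {y, u}. *)
Definition flag_curvature F x y u : R :=
  let g := fundamental_form F x y in
  g (riemann_curvature F x y u) u / (g y y * g u u - g y u ^+ 2).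

(* Density of the Busemann-Hausdorff volume form. *)
Definition sigma_BH F x : R :=
  fine (volume [set y : 'rV[R]_n | enorm y < 1]) /
  fine (volume [set y | F x y < 1]).

Definition S_curvature F x y : R :=
  \sum_i partial_y i (geodesic_coef F i) x y
  - \sum_i y 0 i * 'D_(coord_vec R i) (fun x' => ln (sigma_BH F x')) x.

End Finsler.

Definition coord1 (R : realType) (n : nat) (n_ge2 : (2 <= n)%N)
  (p : 'rV[R]_n) : R := p 0 (Ordinal (ltnW n_ge2)).

Definition coord2 (R : realType) (n : nat) (n_ge2 : (2 <= n)%N)
  (p : 'rV[R]_n) : R := p 0 (Ordinal n_ge2).

Definition fish_tank (R : realType) (n : nat) (n_ge2 : (2 <= n)%N) :
    set 'rV[R]_n :=
  [set p | coord1 n_ge2 p ^+ 2 + coord2 n_ge2 p ^+ 2 < 1].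

Definition fish_tank_metric (R : realType) (n : nat) (n_ge2 : (2 <= n)%N)
    (p w : 'rV[R]_n) : R :=
  let: (x, y) := (coord1 n_ge2 p, coord2 n_ge2 p) in
  let: (u, v) := (coord1 n_ge2 w, coord2 n_ge2 w) in
  (Num.sqrt ((- y * u + x * v) ^+ 2 + enorm w ^+ 2 * (1 - x ^+ 2 - y ^+ 2))
   - (- y * u + x * v)) / (1 - x ^+ 2 - y ^+ 2).

(* Main.v *)
Require Import Defs.
From HB Require Import structures.
From mathcomp Require Import all_boot all_order all_algebra.
From mathcomp Require Import all_classical all_reals all_analysis.
From mathcomp Require Import ring lra.
Set Implicit Arguments.
Unset Strict Implicit.
Unset Printing Implicit Defensive.
Import Order.TTheory GRing.Theory Num.Theory.
Import numFieldNormedType.Exports.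
Local Open Scope classical_set_scope.
Local Open Scope ring_scope.

(** The metric is the solution of a Zermelo navigation problem: for a skew
    matrix A, let a wind with velocity x A blow at the point x (row vectors are
    multiplied on the right), and let F (x, y) be the time that a craft of unit
    airspeed needs for the displacement y.  Then F is the positive root of
    |y - F x A| = F, so that the unit ball of F at x is the Euclidean unit ball
    translated by x A; it contains the origin in its interior where |x A| < 1.
    The fish tank metric is the case where A is the infinitesimal rotation of
    the first two coordinates.  Everything is proved for an arbitrary skew A,
    because skewness, that is, the fact that the wind is a Killing field of the
    Euclidean space, is what makes the curvatures vanish.

    Since the flow of the wind consists of the isometries exp (t A), the unit
    speed geodesics of F are the uniform straight motions carried along by this
    flow, c (t) = (p + t a) exp (t A).  They satisfy c'' = 2 c' A - c A^2, which
    gives by homogeneity the geodesic coefficients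
    G (x, y) = F^2 / 2 x A^2 - F y A, called [geo] below
    ([geodesic_coef_nav]).  The computation rests on the air displacement
    xi = y - F x A, called [air], which satisfies |xi| = F.  The differential of
    F in y is l (v) = <xi, v> / D for a positive function D, called [root], and
    that of F in a direction (a, b) of the tangent bundle is l (b - F a A)
    ([is_derive_nav]).  Along the spray y d/dx - 2 G d/dy the function F is
    constant and xi rotates with speed F, so that every derivative along the
    spray is explicit.  The differential of G in y is - l (v) xi A - F v A, and
    the Riemann curvature is a combination of its derivative along the spray,
    of its square and of the differential of G in x, in which all terms cancel
    ([riemann_coef_nav]).

    For the S-curvature, the divergence of G in y is - l (xi A) - F tr A, which
    vanishes because xi A is orthogonal to xi and A has trace zero
    ([divergence_geo]), and the density of the Busemann-Hausdorff volume is
    constant because the unit balls are translates of each other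
    ([volume_unit_ball]).

    All functions are handled as functions of the pair z = (x, y).  They are
    built by arithmetic and square roots from the coordinates; this class of
    functions is stable under directional derivatives, hence consists of smooth
    functions ([elementary_smooth]), and their directional derivatives depend
    linearly on the direction, which turns the coordinate sums of the
    definitions into single directional derivatives. *)

(** * Smoothness of explicit functions *)

Section OpenSet.
Variables (R : realType) (V : normedModType R) (U : set V).
Hypothesis openU : open U.

Lemma near_open z : U z -> \forall y \near z, U y.
Proof. by move=> Uz; exact: open_nbhs_nbhs. Qed.

Lemma near_open_line z w : U z -> \forall h \near (0 : R), U (h *: w + z).
Proof.
move=> Uz.
have c : {for (0 : R), continuous (fun h : R => h *: w + z)}.
  apply: differentiable_continuous.
  by apply: differentiableD => //; apply: differentiableZl.
by apply: c; rewrite scale0r add0r; exact: near_open.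
Qed.

(** A directional derivative sees the values on one line only.  The functions
    compared below may differ in the other directions, as when the vector y of
    z = (x, y) is frozen before a differentiation in x. *)
Lemma derive_eq_along (f g : V -> R) z w : U z ->
    (forall h : R, U (h *: w + z) -> f (h *: w + z) = g (h *: w + z)) ->
  'D_w f z = 'D_w g z.
Proof.
move=> Uz fg; rewrite /derive; congr (lim _).
have fgz : f z = g z by have := fg 0; rewrite scale0r add0r; apply.
have nfg : \forall h \near (0 : R), h^-1 *: ((f \o shift z) (h *: w) - f z) =
    h^-1 *: ((g \o shift z) (h *: w) - g z).
  near=> h; rewrite /= fgz fg//; near: h; exact: near_open_line.
rewrite eqEsubset; split; apply/near_eq_cvg/cvg_within => //.
by near do apply/esym.
Unshelve. all: by end_near. Qed.

Lemma derive_eq_on (f g : V -> R) z w : U z ->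
  (forall z', U z' -> f z' = g z') -> 'D_w f z = 'D_w g z.
Proof. by move=> Uz fg; apply: derive_eq_along => // h /fg. Qed.

(** The derivatives of the functions below have closed forms on [U] only, so
    that the class [class_C] has to be insensitive to values outside [U]. *)
Lemma class_C_eq (f g : V -> R) k : (forall z, U z -> f z = g z) ->
  class_C k U f -> class_C k U g.
Proof.
elim: k => [|k IH] in f g *; move=> fg [cf Df].
all: have near_fg z (Uz : U z) : {near z, f =1 g}
       by near=> y; apply: fg; near: y; exact: near_open.
all: have cg z (Uz : U z) : {for z, continuous g}
       by rewrite /prop_for /continuous_at -fg//;
          apply: cvg_trans (cf z Uz); apply: near_eq_cvg; exact: near_fg.
  by [].
split=> // v; have [dfv Cfv] := Df v; split.
  by move=> z Uz; apply: near_eq_derivable (dfv z Uz); exact: near_fg.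
by apply: IH Cfv => z Uz; exact: derive_eq_on.
Unshelve. all: by end_near. Qed.

(** A class of functions given by their construction, which reduces smoothness
    to a single induction. *)
Inductive elementary : (V -> R) -> Prop :=
| elementary_cst c : elementary (fun=> c)
| elementary_linear (f : {linear V -> R}) : continuous f -> elementary f
| elementary_add f g : elementary f -> elementary g ->
    elementary (fun z => f z + g z)
| elementary_mul f g : elementary f -> elementary g ->
    elementary (fun z => f z * g z)
| elementary_inv f : elementary f -> (forall z, U z -> f z != 0) ->
    elementary (fun z => (f z)^-1)
| elementary_sqrt f : elementary f -> (forall z, U z -> 0 < f z) ->
    elementary (fun z => Num.sqrt (f z)).

Lemma elementary_opp f : elementary f -> elementary (fun z => - f z).
Proof.
move=> ef; rewrite (_ : (fun _ => _) = (fun z => -1 * f z)).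
  exact: elementary_mul (elementary_cst _) ef.
by apply/funext => z; rewrite mulN1r.
Qed.

Lemma elementary_sub f g : elementary f -> elementary g ->
  elementary (fun z => f z - g z).
Proof. by move=> ef eg; apply/elementary_add/elementary_opp. Qed.

Lemma elementary_div f g : elementary f -> elementary g ->
  (forall z, U z -> g z != 0) -> elementary (fun z => f z / g z).
Proof. by move=> ef eg g0; apply/elementary_mul/elementary_inv. Qed.

Lemma elementary_sqr f : elementary f -> elementary (fun z => f z ^+ 2).
Proof. by move=> ef; apply: elementary_mul. Qed.

Lemma elementary_sum (I : Type) (r : seq I) (f : I -> V -> R) :
  (forall i, elementary (f i)) -> elementary (fun z => \sum_(i <- r) f i z).
Proof.
move=> ef; elim: r => [|i r IH].
  rewrite (_ : (fun _ => _) = fun=> 0); first exact: elementary_cst.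
  by apply/funext => z; rewrite big_nil.
rewrite (_ : (fun _ => _) = (fun z => f i z + \sum_(j <- r) f j z)).
  exact: elementary_add.
by apply/funext => z; rewrite big_cons.
Qed.

Lemma elementary_differentiable f z : elementary f -> U z ->
  differentiable f z.
Proof.
move=> ef Uz; elim: ef => {f} [c|f cf|f g _ df _ dg|f g _ df _ dg
  |f _ df f0|f _ df f0].
- exact: differentiable_cst.
- exact: linear_differentiable.
- exact: differentiableD.
- exact: differentiableM.
- exact/differentiableV/f0.
- apply: (@differentiable_comp _ _ _ _ f (@Num.sqrt R)) => //.
  by apply/derivable1_diffP; have [] := is_derive1_sqrt (f0 _ Uz).
Qed.

Lemma elementary_derivable f z w : elementary f -> U z -> derivable f z w.
Proof. by move=> ef Uz; apply/diff_derivable/elementary_differentiable. Qed.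

Lemma elementary_is_derive f z w : elementary f -> U z ->
  is_derive z w f ('D_w f z).
Proof. by move=> ef Uz; apply/derivableP/elementary_derivable. Qed.

Lemma elementary_derive_linear f z (a : R) u v : elementary f -> U z ->
  'D_(a *: u + v) f z = a * 'D_u f z + 'D_v f z.
Proof.
move=> ef Uz; have df := elementary_differentiable ef Uz.
by rewrite !deriveE// linearP.
Qed.

(** The class is stable under directional derivatives, by the differentiation
    rules; iterating this gives smoothness without any bookkeeping of orders. *)
Lemma elementary_derive f w : elementary f ->
  exists2 g, elementary g & forall z, U z -> 'D_w f z = g z.
Proof.
elim=> {f} [c|f cf|f g ef [f' ef' Df] eg [g' eg' Dg]
  |f g ef [f' ef' Df] eg [g' eg' Dg]|f ef [f' ef' Df] f0|f ef [f' ef' Df] f0].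
- by exists (fun=> 0) => [|z _]; [exact: elementary_cst|exact: derive_cst].
- exists (fun=> f w) => [|z Uz]; first exact: elementary_cst.
  by rewrite deriveE ?diff_lin//; exact: linear_differentiable.
- exists (fun z => f' z + g' z) => [|z Uz]; first exact: elementary_add.
  by rewrite -Df// -Dg//; apply: deriveD; exact: elementary_derivable.
- exists (fun z => f z * g' z + g z * f' z) => [|z Uz].
    by apply: elementary_add; apply: elementary_mul.
  by rewrite -Df// -Dg//; apply: deriveM; exact: elementary_derivable.
- exists (fun z => - ((f z)^-1 * (f z)^-1) * f' z) => [|z Uz].
    apply: elementary_mul => //; apply: elementary_opp.
    by apply: elementary_mul; exact: elementary_inv.
  rewrite -Df// deriveV ?f0//; last exact: elementary_derivable.
  by rewrite expr2 invfM.
- exists (fun z => f' z * (2 * Num.sqrt (f z))^-1) => [|z Uz].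
    apply: elementary_mul => //; apply: elementary_inv => [|z Uz].
      exact: elementary_mul (elementary_cst _) (elementary_sqrt ef f0).
    by rewrite mulf_neq0// gt_eqF// sqrtr_gt0 f0.
  rewrite -Df//.
  have df := elementary_differentiable ef Uz.
  have sq := is_derive1_sqrt (f0 _ Uz).
  have dsq : differentiable (@Num.sqrt R) (f z).
    by apply/derivable1_diffP; have [] := sq.
  rewrite deriveE; last exact: (@differentiable_comp _ _ _ _ f (@Num.sqrt R)).
  rewrite (@diff_comp _ _ _ _ f (@Num.sqrt R))//=.
  have -> : 'd f z w = 'd f z w *: (1 : R) by rewrite /GRing.scale/= mulr1.
  by rewrite linearZ -!deriveE// derive_val.
Qed.

Lemma elementary_smooth f : elementary f -> smooth_on U f.
Proof.
move=> ef k; elim: k f ef => [|k IH] f ef; split=> //.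
1,2: by move=> z Uz; exact/differentiable_continuous/elementary_differentiable.
move=> w; split=> [z Uz|]; first exact: elementary_derivable.
have [g eg Dg] := elementary_derive w ef.
by apply: class_C_eq (IH g eg) => z Uz; rewrite Dg.
Qed.

End OpenSet.

(** * Differentiation rules *)

Section IsDerive.
Variables (R : realType) (V : normedModType R).
Implicit Types (f g : V -> R) (z w : V).

Lemma is_derive_add f g z w df dg : is_derive z w f df -> is_derive z w g dg ->
  is_derive z w (fun y => f y + g y) (df + dg).
Proof. exact: is_deriveD. Qed.

Lemma is_derive_sub f g z w df dg : is_derive z w f df -> is_derive z w g dg ->
  is_derive z w (fun y => f y - g y) (df - dg).
Proof. exact: is_deriveB. Qed.

Lemma is_derive_mul f g z w df dg : is_derive z w f df -> is_derive z w g dg ->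
  is_derive z w (fun y => f y * g y) (df * g z + f z * dg).
Proof.
by move=> ? ?; apply: is_derive_eq (is_deriveM _ _) _;
  rewrite addrC mulrC.
Qed.

(** The shape of the derivative of the quotient q = f / g, namely
    (df - q dg) / g, keeps q as a block in later computations. *)
Lemma is_derive_div f g z w df dg : g z != 0 ->
  is_derive z w f df -> is_derive z w g dg ->
  is_derive z w (fun y => f y / g y) ((df - f z / g z * dg) / g z).
Proof.
move=> gz0 Df [dg1 dg2].
have Dg : is_derive z w (fun y => (g y)^-1) (- (g z) ^- 2 * dg).
  by apply: DeriveDef; [exact: derivableV|rewrite deriveV// dg2].
apply: is_derive_eq (is_derive_mul Df Dg) _.
by field.
Qed.

Lemma is_derive_sum (I : Type) (r : seq I) (f : I -> V -> R) (df : I -> R) z w :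
  (forall i, is_derive z w (f i) (df i)) ->
  is_derive z w (fun y => \sum_(i <- r) f i y) (\sum_(i <- r) df i).
Proof.
move=> Df; elim: r => [|i r IH].
  rewrite big_nil (_ : (fun _ => _) = cst 0); first exact: is_derive_cst.
  by apply/funext => y; rewrite big_nil.
rewrite big_cons (_ : (fun _ => _) = (fun y => f i y + \sum_(j <- r) f j y)).
  exact: is_derive_add.
by apply/funext => y; rewrite big_cons.
Qed.

End IsDerive.

Section DotProduct.
Variables (R : realType) (n : nat).
Implicit Types (a b c : 'rV[R]_n) (B : 'M[R]_n).

Definition dot a b : R := \sum_i a 0 i * b 0 i.

Lemma dotC a b : dot a b = dot b a.
Proof. by apply: eq_bigr => i _; rewrite mulrC. Qed.

Lemma dotDl a b c : dot (a + b) c = dot a c + dot b c.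
Proof. by rewrite -big_split; apply: eq_bigr => i _; rewrite mxE mulrDl. Qed.

Lemma dotZl (k : R) a b : dot (k *: a) b = k * dot a b.
Proof. by rewrite mulr_sumr; apply: eq_bigr => i _; rewrite mxE mulrA. Qed.

Lemma dotNl a b : dot (- a) b = - dot a b.
Proof. by rewrite -scaleN1r dotZl mulN1r. Qed.

Lemma dotDr a b c : dot a (b + c) = dot a b + dot a c.
Proof. by rewrite dotC dotDl !(dotC a). Qed.

Lemma dotZr (k : R) a b : dot a (k *: b) = k * dot a b.
Proof. by rewrite dotC dotZl dotC. Qed.

Lemma dotNr a b : dot a (- b) = - dot a b.
Proof. by rewrite dotC dotNl dotC. Qed.

Definition dotE := (dotDl, dotDr, dotZl, dotZr, dotNl, dotNr).

Lemma dot_coord a i : dot a (coord_vec R i) = a 0 i.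
Proof.
rewrite /dot (bigD1 i)//= big1 ?addr0 => [|j ji]; rewrite mxE eqxx ?eqxx/=.
  by rewrite mulr1.
by rewrite (negbTE ji) mulr0.
Qed.

Lemma dot_mulmxr a b B : dot a (b *m B) = dot (a *m B^T) b.
Proof.
rewrite /dot; under eq_bigr do rewrite mxE mulr_sumr.
rewrite exchange_big; apply: eq_bigr => i _; rewrite mxE mulr_suml.
by apply: eq_bigr => j _; rewrite mxE mulrCA mulrC.
Qed.

Lemma dot_ge0 a : 0 <= dot a a.
Proof. by apply: sumr_ge0 => i _; rewrite -expr2 sqr_ge0. Qed.

Lemma dot_gt0 a : a != 0 -> 0 < dot a a.
Proof.
move=> a0; rewrite lt_def dot_ge0 andbT; apply: contra_neq a0 => aa0.
apply/rowP => i; rewrite mxE; apply/eqP; rewrite -sqrf_eq0 expr2; apply/eqP.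
by apply: (psumr_eq0P _ aa0) => // j _; rewrite -expr2 sqr_ge0.
Qed.

Lemma dot_CauchySchwarz a b : dot a b ^+ 2 <= dot a a * dot b b.
Proof.
have [->|b0] := eqVneq b 0.
  by rewrite -(scale0r 0) !dotE !mul0r expr0n mulr0.
have bb := dot_gt0 b0.
have := dot_ge0 (dot b b *: a - dot a b *: b).
rewrite !dotE (dotC b a) => h; rewrite -(ler_pM2r bb).
rewrite -subr_ge0; apply: le_trans h _.
by rewrite le_eqVlt; apply/orP; left; apply/eqP; ring.
Qed.

(** Contractions over coordinates in the definitions are recognised as values of
    linear functions by this expansion, read from right to left. *)
Lemma row_linear_sum (f : 'rV[R]_n -> R) :
  (forall (k : R) u v, f (k *: u + v) = k * f u + f v) ->
  forall u, f u = \sum_i u 0 i * f (coord_vec R i).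
Proof.
move=> lf u; have f0 : f 0 = 0.
  by have := lf 1 0 0; rewrite scale1r addr0 mul1r => /eqP; rewrite -subr_eq0
    opprD addrA subrr sub0r oppr_eq0 => /eqP.
have fD v w : f (v + w) = f v + f w by rewrite -[v in LHS]scale1r lf mul1r.
rewrite {1}[u]row_sum_delta (big_morph f fD f0); apply: eq_bigr => i _.
by rewrite -[_ *: _]addr0 lf f0 addr0.
Qed.

End DotProduct.

(** * Functions of a point and a vector *)

Section PhaseSpace.
Variables (R : realType) (n : nat).
Local Notation V := 'rV[R]_n.
Local Notation Z := (V * V)%type.
Implicit Types (z w : Z) (f g : Z -> V).

Lemma coord_linear (i : 'I_n) (pr : Z -> V) :
    (forall (k : R) z w, pr (k *: z + w) = k *: pr z + pr w) -> continuous pr ->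
  {l : {linear Z -> R} | continuous l & forall z, l z = pr z 0 i}.
Proof.
move=> lpr cpr; pose l z := pr z 0 i.
have ll : linear l by move=> k z w; rewrite /l lpr !mxE.
pose lM := GRing.isLinear.Build _ _ _ _ l ll.
pose L : {linear Z -> R} := HB.pack l lM.
exists L => // z; apply: (@continuous_comp _ _ _ pr (fun a : V => a 0 i)).
  exact: cpr.
exact: coord_continuous.
Qed.

Variable U : set Z.

Lemma elementary_fst i : elementary U (fun z => z.1 0 i).
Proof.
have [|z|l cl lE] := @coord_linear i fst; [by []|exact: cvg_fst|].
by rewrite (_ : (fun _ => _) = l); [exact: elementary_linear|exact/funext].
Qed.

Lemma elementary_snd i : elementary U (fun z => z.2 0 i).
Proof.
have [|z|l cl lE] := @coord_linear i snd; [by []|exact: cvg_snd|].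
by rewrite (_ : (fun _ => _) = l); [exact: elementary_linear|exact/funext].
Qed.

Lemma elementary_mulmx f (B : 'M[R]_n) :
  (forall i, elementary U (fun z => f z 0 i)) ->
  forall i, elementary U (fun z => (f z *m B) 0 i).
Proof.
move=> ef i; rewrite (_ : (fun _ => _) = fun z => \sum_j f z 0 j * B j i).
  by apply: elementary_sum => j; apply/elementary_mul/elementary_cst.
by apply/funext => z; rewrite mxE.
Qed.

Lemma elementary_dot f g : (forall i, elementary U (fun z => f z 0 i)) ->
  (forall i, elementary U (fun z => g z 0 i)) ->
  elementary U (fun z => dot (f z) (g z)).
Proof. by move=> ef eg; apply: elementary_sum => i; exact: elementary_mul. Qed.

Lemma is_derive_fst i z w : is_derive z w (fun z => z.1 0 i) (w.1 0 i).
Proof.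
have [|y|l cl lE] := @coord_linear i fst; [by []|exact: cvg_fst|].
rewrite (_ : (fun _ => _) = l); last exact/esym/funext.
have dl : differentiable l z by exact: linear_differentiable.
by apply: DeriveDef; [exact: diff_derivable|rewrite deriveE// diff_lin// lE].
Qed.

Lemma is_derive_snd i z w : is_derive z w (fun z => z.2 0 i) (w.2 0 i).
Proof.
have [|y|l cl lE] := @coord_linear i snd; [by []|exact: cvg_snd|].
rewrite (_ : (fun _ => _) = l); last exact/esym/funext.
have dl : differentiable l z by exact: linear_differentiable.
by apply: DeriveDef; [exact: diff_derivable|rewrite deriveE// diff_lin// lE].
Qed.

Lemma is_derive_mulmx f (B : 'M[R]_n) z w (df : V) :
  (forall i, is_derive z w (fun z => f z 0 i) (df 0 i)) ->
  forall i, is_derive z w (fun z => (f z *m B) 0 i) ((df *m B) 0 i).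
Proof.
move=> Df i; rewrite mxE (_ : (fun _ => _) = fun z => \sum_j f z 0 j * B j i).
  apply: is_derive_sum => j.
  apply: is_derive_eq (is_derive_mul (Df j) (is_derive_cst (B j i) z w)) _.
  by rewrite mulr0 addr0.
by apply/funext => y; rewrite mxE.
Qed.

Lemma is_derive_dot f g z w (df dg : V) :
  (forall i, is_derive z w (fun z => f z 0 i) (df 0 i)) ->
  (forall i, is_derive z w (fun z => g z 0 i) (dg 0 i)) ->
  is_derive z w (fun z => dot (f z) (g z)) (dot df (g z) + dot (f z) dg).
Proof.
move=> Df Dg; rewrite -big_split; apply: is_derive_sum => i.
exact: is_derive_mul.
Qed.

Lemma is_derive_dotl f v z w (df : V) :
  (forall i, is_derive z w (fun z => f z 0 i) (df 0 i)) ->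
  is_derive z w (fun z => dot (f z) v) (dot df v).
Proof.
move=> Df; apply: is_derive_sum => i.
apply: is_derive_eq (is_derive_mul (Df i) (is_derive_cst (v 0 i) z w)) _.
by rewrite mulr0 addr0.
Qed.

End PhaseSpace.

(** Directional derivatives in different spaces agree when the restrictions to
    the two lines do; this moves a partial derivative to the product space. *)
Lemma derive_same_line (R : realType) (V W : normedModType R)
    (f : V -> R) (g : W -> R) x v z w :
  (forall h : R, f (h *: v + x) = g (h *: w + z)) -> 'D_v f x = 'D_w g z.
Proof.
move=> fg; have fgx : f x = g z by have := fg 0; rewrite !scale0r !add0r.
rewrite /derive; under eq_fun => h do rewrite /= fg fgx.
by [].
Qed.

Section ProductDerivatives.
Variables (R : realType) (V W : normedModType R).

Lemma derive_fst (f : V -> W -> R) x y v :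
  'D_v (fun x' => f x' y) x = 'D_(v, 0) (fun z : V * W => f z.1 z.2) (x, y).
Proof. by apply: derive_same_line => h /=; rewrite scaler0 add0r. Qed.

Lemma derive_snd (f : V -> W -> R) x y v :
  'D_v (f x) y = 'D_(0, v) (fun z : V * W => f z.1 z.2) (x, y).
Proof. by apply: derive_same_line => h /=; rewrite scaler0 add0r. Qed.

Lemma derive1_line (f : V -> R) a v :
  derive1 (fun t : R => f (a + t *: v)) 0 = 'D_v f a.
Proof.
rewrite derive1E; apply: derive_same_line => h /=.
by rewrite addr0 /GRing.scale/= mulr1 addrC.
Qed.

End ProductDerivatives.

Lemma fundamental_formE (R : realType) n (F : 'rV[R]_n -> 'rV[R]_n -> R)
    x y u v :
  fundamental_form F x y u v =
  2^-1 * 'D_u ('D_v (fun y => F x y ^+ 2)) y.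
Proof.
rewrite /fundamental_form.
under eq_fun do rewrite (derive1_line (fun y => F x y ^+ 2)).
by rewrite (derive1_line (fun y => 'D_v (fun y => F x y ^+ 2) y)).
Qed.

(** * Translation invariance of the volume *)

Section Volume.
Variables (R : realType) (n : nat).
Implicit Types (D : set 'rV[R]_n) (c : 'rV[R]_n).

(** Translating the boxes of a cover does not change their volumes; the reverse
    inequality is the same one for the opposite translation. *)
Lemma volume_translate_le c D :
  (volume [set y : 'rV[R]_n | D (y - c)%R] <= volume D)%E.
Proof.
apply: ereal_inf_le_tmp => _ [B [B_le DB] <-].
pose B' k := ((B k).1 + c, (B k).2 + c).
exists B'; first split=> [k i|y /DB[k _ By]].
- by rewrite !mxE lerD2r.
- by exists k => // i; have := By i; rewrite !mxE ltrBrDr lerBlDr.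
congr (limn _); apply/funext => m; apply: eq_bigr => k _; congr (_%:E).
by apply: eq_bigr => i _; rewrite !mxE; ring.
Qed.

Lemma volume_translate c D : volume [set y : 'rV[R]_n | D (y - c)%R] = volume D.
Proof.
apply/eqP; rewrite eq_le volume_translate_le/=.
rewrite [X in (volume X <= _)%E](_ : D =
    [set y | [set y' | D (y' - c)] (y - - c)]); last first.
  by apply/funext => y /=; rewrite opprK addrK.
exact: volume_translate_le.
Qed.

End Volume.

(** The shape of the curvature: [s1 - 2 * s2] is a derivative along the spray,
    which collects the two middle sums of the curvature up to sign. *)
Lemma curvature_combination (R : realType) (a b c d p s1 s2 q r : R) :
  a = p -> b = s1 -> c = s2 -> d = q -> s1 - 2 * s2 = r -> 2 * p - r - q = 0 ->
  2 * a - b + 2 * c - d = 0.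
Proof. by move=> -> -> -> -> <- e; lra. Qed.

(** * The navigation metric of a Killing wind *)

Section Navigation.
Variables (R : realType) (n : nat) (A : 'M[R]_n).
Hypothesis skewA : A^T = - A.
Local Notation V := 'rV[R]_n.
Local Notation Z := (V * V)%type.
Local Notation e_ i := (coord_vec R i).
Implicit Types (x y u v : V) (z w : Z).

Lemma dot_skew u v : dot u (v *m A) = - dot (u *m A) v.
Proof. by rewrite dot_mulmxr skewA mulmxN dotNl. Qed.

Lemma dot_skew_self u : dot (u *m A) u = 0.
Proof.
have := dot_skew u u; rewrite dotC => /eqP.
by rewrite -addr_eq0 -mulr2n mulrn_eq0 => /eqP.
Qed.

(** The time [nav] solves the quadratic equation
    slack t^2 + 2 drift t = |y|^2, which is |y - t wind|^2 = t^2 expanded; its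
    reduced discriminant is the square of [root]. *)
Definition wind z : V := z.1 *m A.
Definition slack z : R := 1 - dot (wind z) (wind z).
Definition drift z : R := dot (wind z) z.2.
Definition root z : R :=
  Num.sqrt (drift z ^+ 2 + dot z.2 z.2 * slack z).
Definition nav z : R := (root z - drift z) / slack z.
Definition air z : V := z.2 - nav z *: wind z.
(** The differential of the time in the vector variable: differentiating
    |air|^2 = nav^2 gives <air, v - dnav v wind> = nav dnav v, and
    <air, wind> + nav = root. *)
Definition dnav z v : R := dot (air z) v / root z.

Definition calm : set V := [set x | dot (x *m A) (x *m A) < 1].
Definition phase : set Z := calm `*` ~` [set 0].

Lemma air_add_wind z : air z + nav z *: wind z = z.2.
Proof. by rewrite /air subrK. Qed.

Section Point.
Variable z : Z.
Hypothesis calm_z : calm z.1.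

Lemma slack_gt0 : 0 < slack z.
Proof. by rewrite subr_gt0. Qed.
Let slack_neq0 : slack z != 0.
Proof. by rewrite gt_eqF ?slack_gt0. Qed.

Lemma root_sqr : root z ^+ 2 = drift z ^+ 2 + dot z.2 z.2 * slack z.
Proof.
by rewrite sqr_sqrtr// addr_ge0 ?sqr_ge0// mulr_ge0 ?dot_ge0// ltW ?slack_gt0.
Qed.

(** The derivative of half the quadratic equation at its solution; this is why
    implicit differentiation of the time leads to the denominator [root]. *)
Lemma rootE : root z = slack z * nav z + drift z.
Proof. by rewrite /nav; field. Qed.

Lemma nav_quadratic :
  slack z * (nav z * nav z) + 2 * (drift z * nav z) = dot z.2 z.2.
Proof.
suff : slack z * (slack z * (nav z * nav z) + 2 * (drift z * nav z)) =
    slack z * dot z.2 z.2 by move/(mulfI slack_neq0).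
have := root_sqr; rewrite rootE => e.
have -> : slack z * dot z.2 z.2 =
  drift z ^+ 2 + dot z.2 z.2 * slack z - drift z ^+ 2 by ring.
by rewrite -e; ring.
Qed.

Lemma norm_drift_le_root : `|drift z| <= root z.
Proof.
rewrite -sqrtr_sqr ler_wsqrtr// lerDl mulr_ge0 ?dot_ge0//.
exact/ltW/slack_gt0.
Qed.

Lemma nav_ge0 : 0 <= nav z.
Proof.
rewrite divr_ge0 ?(ltW slack_gt0)// subr_ge0.
exact: le_trans (ler_norm _) norm_drift_le_root.
Qed.

Lemma air_sqr : dot (air z) (air z) = nav z ^+ 2.
Proof.
have := nav_quadratic; rewrite /slack /drift /air !dotE.
rewrite (dotC z.2 (wind z)) => e.
transitivity (dot z.2 z.2 - 2 * nav z * dot (wind z) z.2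
   + nav z ^+ 2 * dot (wind z) (wind z)); first by ring.
by rewrite -e; ring.
Qed.

Lemma dot_air_wind : dot (air z) (wind z) = root z - nav z.
Proof.
by rewrite rootE /air /slack /drift !dotE (dotC z.2); ring.
Qed.

Lemma dot_air_snd : dot (air z) z.2 = nav z * root z.
Proof.
rewrite -[X in dot _ X]air_add_wind.
by rewrite dotDr dotZr air_sqr dot_air_wind; ring.
Qed.

(** On the positive half-line the polynomial slack t^2 + 2 drift t - |y|^2 is
    positive exactly beyond its nonnegative root, and its value at t = 1 is
    1 - |y - wind|^2. *)
Lemma nav_lt1 : (nav z < 1) = (dot (z.2 - wind z) (z.2 - wind z) < 1).
Proof.
rewrite -subr_gt0 -[RHS]subr_gt0.
have -> : 1 - dot (z.2 - wind z) (z.2 - wind z) =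
    (1 - nav z) * (slack z + root z + drift z).
  have := nav_quadratic; rewrite rootE /slack /drift !dotE.
  rewrite (dotC z.2 (wind z)) => e.
  transitivity (1 - dot (wind z) (wind z) + 2 * dot (wind z) z.2 - dot z.2 z.2).
    by ring.
  by rewrite -e; ring.
rewrite pmulr_lgt0//; have := slack_gt0; have := norm_drift_le_root.
rewrite ler_norml => /andP[]; lra.
Qed.

End Point.

Section PhasePoint.
Variable z : Z.
Hypothesis phase_z : phase z.

Let calm_z : calm z.1. Proof. by case: phase_z. Qed.

Lemma phase_snd_neq0 : z.2 != 0.
Proof. by case: phase_z => _ /eqP. Qed.

Lemma radicand_gt0 : 0 < drift z ^+ 2 + dot z.2 z.2 * slack z.
Proof.
by rewrite ltr_wpDl ?sqr_ge0// mulr_gt0 ?slack_gt0// dot_gt0// phase_snd_neq0.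
Qed.

Lemma root_gt0 : 0 < root z.
Proof. by rewrite sqrtr_gt0 radicand_gt0. Qed.

Lemma nav_gt0 : 0 < nav z.
Proof.
rewrite lt_def nav_ge0// andbT; apply/negP => /eqP n0.
have := nav_quadratic calm_z; rewrite n0 !mulr0 addr0 => /esym/eqP.
by rewrite gt_eqF// dot_gt0// phase_snd_neq0.
Qed.

Lemma root_neq0 : root z != 0. Proof. by rewrite gt_eqF ?root_gt0. Qed.

Lemma dot_airE v : dot (air z) v = root z * dnav z v.
Proof. by rewrite /dnav mulrC divfK ?root_neq0. Qed.

Lemma dnav_snd : dnav z z.2 = nav z.
Proof. by rewrite /dnav dot_air_snd// mulfK ?root_neq0. Qed.

(** An infinitesimal rotation of the air displacement costs no time to first
    order. *)
Lemma dnav_air_skew : dnav z (air z *m A) = 0.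
Proof. by rewrite /dnav dotC dot_skew_self mul0r. Qed.

End PhasePoint.

Lemma elementary_wind U i : elementary U (fun z => wind z 0 i).
Proof. exact/elementary_mulmx/elementary_fst. Qed.

Lemma elementary_slack U : elementary U slack.
Proof.
apply/elementary_sub/elementary_dot; first exact: elementary_cst.
all: exact: elementary_wind.
Qed.

Lemma elementary_drift U : elementary U drift.
Proof.
by apply/elementary_dot => i; [exact: elementary_wind|exact: elementary_snd].
Qed.

Lemma elementary_root : elementary phase root.
Proof.
apply: elementary_sqrt => [|z /radicand_gt0//].
apply: elementary_add; first exact/elementary_sqr/elementary_drift.
apply: elementary_mul; last exact: elementary_slack.
by apply/elementary_dot; exact: elementary_snd.
Qed.

Lemma elementary_nav : elementary phase nav.
Proof.
apply: elementary_div => [| |z [/slack_gt0 ?]]; last by rewrite gt_eqF.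
  by apply: elementary_sub; [exact: elementary_root|exact: elementary_drift].
exact: elementary_slack.
Qed.

Lemma elementary_air i : elementary phase (fun z => air z 0 i).
Proof.
rewrite (_ : (fun _ => _) = fun z => z.2 0 i - nav z * wind z 0 i).
  apply: elementary_sub; first exact: elementary_snd.
  by apply: elementary_mul; [exact: elementary_nav|exact: elementary_wind].
by apply/funext => z; rewrite !mxE.
Qed.

Lemma elementary_dnav v : elementary phase (fun z => dnav z v).
Proof.
apply: elementary_div; last by move=> z /root_neq0.
  by apply: elementary_dot => i; [exact: elementary_air|exact: elementary_cst].
exact: elementary_root.
Qed.

Lemma open_calm : open calm.
Proof.
have cf : continuous (fun x : V => slack (x, 0)).
  move=> x; apply: (@continuous_comp _ _ _ (fun x : V => (x, 0 : V)) slack).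
    by apply: differentiable_continuous; exact: differentiable_pair.
  apply: differentiable_continuous.
  exact: (elementary_differentiable (elementary_slack setT)).
rewrite (_ : calm = (fun x : V => slack (x, 0)) @^-1` [set t | 0 < t]).
  by apply: open_comp => //; exact: open_gt.
by apply/seteqP; split=> x; rewrite /calm/= subr_gt0.
Qed.

Lemma open_phase : open phase.
Proof.
rewrite (_ : phase = fst @^-1` calm `&` snd @^-1` ~` [set 0]); last by [].
apply: openI; apply: open_comp.
- by move=> z _; exact: cvg_fst.
- exact: open_calm.
- by move=> z _; exact: cvg_snd.
- apply: closed_openC; apply: accessible_closed_set1.
  exact/hausdorff_accessible/norm_hausdorff.
Qed.

(** The vertical vector with the same effect on the time as the direction
    [w = (a, b)]: moving the point by a changes the wind by a A, and the
    displacement has to follow by [nav z] times this change to take the same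
    time. *)
Definition vert z w : V := w.2 - nav z *: (w.1 *m A).

Section Derivatives.
Variables (z w : Z).
Hypothesis phase_z : phase z.

Let calm_z : calm z.1. Proof. by case: phase_z. Qed.

Lemma is_derive_wind i : is_derive z w (fun z => wind z 0 i) ((w.1 *m A) 0 i).
Proof. by apply: (@is_derive_mulmx _ _ fst) => j; exact: is_derive_fst. Qed.

Lemma is_derive_slack :
  is_derive z w slack (- 2 * dot (w.1 *m A) (wind z)).
Proof.
have D := is_derive_dot is_derive_wind is_derive_wind.
apply: is_derive_eq (is_derive_sub (is_derive_cst (1 : R) z w) D) _.
by rewrite sub0r (dotC (wind z)); ring.
Qed.

Lemma is_derive_drift :
  is_derive z w drift (dot (w.1 *m A) z.2 + dot (wind z) w.2).
Proof.
by apply: is_derive_dot => i; [exact: is_derive_wind|exact: is_derive_snd].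
Qed.

(** Implicit differentiation of the quadratic equation [nav_quadratic]; the
    coefficient of the unknown derivative is twice [root]. *)
Lemma is_derive_nav : is_derive z w nav (dnav z (vert z w)).
Proof.
have D := elementary_is_derive w elementary_nav phase_z.
suff -> : dnav z (vert z w) = 'D_w nav z by [].
have /is_derive_mul/(_ D) := D; move/(is_derive_mul is_derive_slack) => D1.
have D2 := is_derive_mul (is_derive_cst (2 : R) z w)
  (is_derive_mul is_derive_drift D).
have [_ E1] := is_derive_add D1 D2.
have [_ E2] := is_derive_dot (fun i => is_derive_snd i z w)
  (fun i => is_derive_snd i z w).
have E : 'D_w (fun y : Z => slack y * (nav y * nav y)
      + cst (2 : R) y * (drift y * nav y)) z
    = 'D_w (fun y : Z => dot y.2 y.2) z.
  apply: (derive_eq_on open_phase) => // y [cy _].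
  exact: nav_quadratic.
move: E; rewrite E1 E2 => E.
apply: (mulIf (root_neq0 phase_z)).
rewrite /dnav divfK ?root_neq0// rootE//.
move: E; rewrite /air /vert /drift /cst !dotE (dotC z.2 w.2).
rewrite (dotC z.2 (w.1 *m A)) (dotC (wind z) w.2) (dotC (wind z) z.2).
rewrite (dotC (wind z) (w.1 *m A)).
lra.
Qed.

Lemma is_derive_root : is_derive z w root
  (slack z * dnav z (vert z w) + dot (vert z w) (wind z)
   + dot (air z) (w.1 *m A)).
Proof.
have [_ E] := is_derive_add (is_derive_mul is_derive_slack is_derive_nav)
  is_derive_drift.
have e := elementary_is_derive w elementary_root phase_z.
apply: is_derive_eq e _.
have -> : 'D_w root z = 'D_w (fun y : Z => slack y * nav y + drift y) z.
  by apply: (derive_eq_on open_phase) => // y [cy _]; exact: rootE.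
rewrite E /air /vert !dotE (dotC (wind z) w.2) (dotC (wind z) (w.1 *m A)).
rewrite (dotC z.2 (w.1 *m A)).
ring.
Qed.

Lemma is_derive_air i : is_derive z w (fun z => air z 0 i)
  ((vert z w - dnav z (vert z w) *: wind z) 0 i).
Proof.
rewrite (_ : (fun _ => _) = fun z => z.2 0 i - nav z * wind z 0 i).
  apply: is_derive_eq (is_derive_sub (is_derive_snd i z w)
    (is_derive_mul is_derive_nav (is_derive_wind i))) _.
  by rewrite /vert !mxE; ring.
by apply/funext => y; rewrite !mxE.
Qed.

Lemma is_derive_dnav v : is_derive z w (fun z => dnav z v)
  ((dot (vert z w - dnav z (vert z w) *: wind z) v
    - dnav z v * (slack z * dnav z (vert z w) + dot (vert z w) (wind z)
                  + dot (air z) (w.1 *m A))) / root z).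
Proof.
exact: is_derive_div (root_neq0 phase_z) (is_derive_dotl v is_derive_air)
  is_derive_root.
Qed.

End Derivatives.

(** The closed form of the fundamental tensor, arranged so that symmetry and,
    through the Cauchy-Schwarz inequality, positivity are visible. *)
Definition gform z u v : R := dnav z u * dnav z v + nav z / root z *
  (dot (u - dnav z u *: wind z) (v - dnav z v *: wind z)
   - dnav z u * dnav z v).

Lemma dnav_linear z (k : R) u v :
  dnav z (k *: u + v) = k * dnav z u + dnav z v.
Proof. by rewrite /dnav !dotE; ring. Qed.

Lemma gform_linear z (k : R) u v v' :
  gform z (k *: u + v) v' = k * gform z u v' + gform z v v'.
Proof. by rewrite /gform dnav_linear !dotE; ring. Qed.

Lemma gformZl z (k : R) u v : gform z (k *: u) v = k * gform z u v.
Proof.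
have g0 : gform z 0 v = 0.
  by have := gform_linear z (-1) 0 0 v; rewrite scaler0 addr0; lra.
by have := gform_linear z k u 0 v; rewrite g0 !addr0.
Qed.

Lemma gformC z u v : gform z u v = gform z v u.
Proof. by rewrite /gform dotC (mulrC (dnav z u)). Qed.

Lemma elementary_gform u v : elementary phase (fun z => gform z u v).
Proof.
have ed i a : elementary phase (fun z => (a - dnav z a *: wind z) 0 i).
  rewrite (_ : (fun _ => _) = fun z => a 0 i - dnav z a * wind z 0 i).
    apply/elementary_sub/elementary_mul; first exact: elementary_cst.
      exact: elementary_dnav.
    exact: elementary_wind.
  by apply/funext => y; rewrite !mxE.
have euv : elementary phase (fun z => dnav z u * dnav z v).
  by apply: elementary_mul; exact: elementary_dnav.
apply: elementary_add => //; apply/elementary_mul/elementary_sub => //.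
  apply: elementary_div; [exact: elementary_nav|exact: elementary_root|].
  by move=> z /root_neq0.
by apply: elementary_dot => i; exact: ed.
Qed.

Section PhasePointForm.
Variable z : Z.
Hypothesis phase_z : phase z.

Let calm_z : calm z.1. Proof. by case: phase_z. Qed.

Lemma is_derive_sqr_nav w :
  is_derive z w (fun z => nav z ^+ 2) (2 * (nav z * dnav z (vert z w))).
Proof.
have D := is_derive_nav w phase_z; apply: is_derive_eq (is_derive_mul D D) _.
ring.
Qed.

(** The quantity nav dnav v is half the derivative of the squared metric, that
    is, the momentum dual to the vector z.2.  In vertical directions its
    derivative is the fundamental tensor; the last term is what moving the
    point adds to it. *)
Lemma is_derive_nav_dnav v w :
  is_derive z w (fun z => nav z * dnav z v)
    (gform z (vert z w) v
     - nav z / root z * dnav z v * dot (air z) (w.1 *m A)).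
Proof.
apply: is_derive_eq (is_derive_mul (is_derive_nav w phase_z)
  (is_derive_dnav w phase_z v)) _.
rewrite /gform /slack; move: (vert z w) (dot (air z) _) => t d.
by rewrite !dotE (dotC t (wind z)); field; exact: root_neq0.
Qed.

Lemma gform_snd v : gform z z.2 v = nav z * dnav z v.
Proof.
rewrite /gform dnav_snd// -/(air z) dotDr dotNr dotZr dot_air_wind// dot_airE//.
by field; exact: root_neq0.
Qed.

(** With u' = u - l wind and l = dnav u, one has nav l = <air, u'> and
    |air| = nav, so that l^2 <= |u'|^2. *)
Lemma gform_gt0 u : u != 0 -> 0 < gform z u u.
Proof.
move=> u0; set l := dnav z u; set u' := u - l *: wind z.
have r0 := root_gt0 phase_z; have n0 := nav_gt0 phase_z.
have lE : nav z * l = dot (air z) u'.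
  rewrite /u' dotDr dotNr dotZr dot_air_wind//.
  by rewrite dot_airE// -/l; ring.
have CS : l ^+ 2 <= dot u' u'.
  have := dot_CauchySchwarz (air z) u'.
  by rewrite -lE air_sqr// exprMn ler_pM2l// exprn_gt0.
have gE : gform z u u = l ^+ 2 + nav z / root z * (dot u' u' - l ^+ 2).
  by rewrite /gform -/l -/u' expr2.
rewrite gE; have [l0|l0] := eqVneq l 0.
  have -> : u' = u by rewrite /u' l0 scale0r subr0.
  rewrite l0 expr0n/= add0r subr0; apply: mulr_gt0; first exact: divr_gt0.
  exact: dot_gt0.
rewrite ltr_wpDr ?exprn_even_gt0// mulr_ge0 ?subr_ge0//.
by rewrite divr_ge0 ?ltW.
Qed.

End PhasePointForm.

Definition nav_metric x y : R := nav (x, y).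
Local Notation F := nav_metric.

Lemma vert_snd z v : vert z (0, v) = v.
Proof. by rewrite /vert mul0mx scaler0 subr0. Qed.

Lemma vert_fst z v : vert z (v, 0) = - (nav z *: (v *m A)).
Proof. by rewrite /vert sub0r. Qed.

Lemma derive_snd_sqr_nav z v : phase z ->
  'D_v (fun y => F z.1 y ^+ 2) z.2 = 2 * (nav z * dnav z v).
Proof.
move=> pz; rewrite (derive_snd (fun x y => F x y ^+ 2)).
rewrite (_ : (fun _ => _) = fun z => nav z ^+ 2); last by apply/funext; case.
case: z pz => x y pz /=.
by have [_ ->] := is_derive_sqr_nav pz (0, v); rewrite vert_snd.
Qed.

Lemma derive_snd_snd_sqr_nav x y u v : phase (x, y) ->
  'D_u ('D_v (fun y => F x y ^+ 2)) y = 2 * gform (x, y) u v.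
Proof.
move=> pz; rewrite (derive_snd (fun x => 'D_v (fun y => F x y ^+ 2))).
rewrite (@derive_eq_on _ _ _ open_phase _
   (fun z => cst (2 : R) z * (nav z * dnav z v)))//; last first.
  by move=> z pz'; exact: derive_snd_sqr_nav.
have [_ ->] := is_derive_mul (is_derive_cst (2 : R) (x, y) (0, u))
  (is_derive_nav_dnav pz v (0, u)).
rewrite vert_snd mul0mx mul0r add0r.
rewrite [dot _ 0](_ : _ = 0) ?mulr0 ?subr0//.
by rewrite -(scale0r 0) dotZr mul0r.
Qed.

Lemma fundamental_form_nav x y u v : phase (x, y) ->
  fundamental_form F x y u v = gform (x, y) u v.
Proof.
move=> pz; rewrite fundamental_formE derive_snd_snd_sqr_nav//.
by rewrite mulKf// pnatr_eq0.
Qed.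

Lemma metric_tensor_nav x y i j : phase (x, y) ->
  metric_tensor F x y i j = gform (x, y) (e_ i) (e_ j).
Proof.
move=> pz; rewrite mxE /partial_y derive_snd_snd_sqr_nav//.
by rewrite mulKf ?pnatr_eq0// gformC.
Qed.

Lemma finsler_nav : finsler_metric calm F.
Proof.
split.
- exact: open_calm.
- by move=> x y cx; exact: nav_ge0.
- rewrite (_ : (fun _ => _) = nav); last by apply/funext; case.
  exact/elementary_smooth/elementary_nav/open_phase.
- move=> x y k cx k0; rewrite /nav_metric /nav /root /drift /slack /wind/=.
  rewrite !dotE.
  have -> : (k * dot (x *m A) y) ^+ 2 +
      k * (k * dot y y) * (1 - dot (x *m A) (x *m A)) =
      k ^+ 2 * (dot (x *m A) y ^+ 2 + dot y y * (1 - dot (x *m A) (x *m A))).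
    by ring.
  by rewrite sqrtrM ?sqr_ge0// sqrtr_sqr gtr0_norm// -mulrBr mulrA.
- move=> x y cx y0; have pz : phase (x, y) by split=> //; apply/eqP.
  split=> [k u v w|u v|u u0]; rewrite !fundamental_form_nav//.
  + exact: gform_linear.
  + exact: gformC.
  + exact: gform_gt0.
Qed.

(** A vector in the kernel would be orthogonal to itself. *)
Lemma metric_tensor_unit x y : phase (x, y) -> metric_tensor F x y \in unitmx.
Proof.
move=> pz; rewrite -row_free_unit -kermx_eq0; apply/rowV0P => u /sub_kermxP uM.
apply/eqP; apply: contraT => /(gform_gt0 pz); rewrite ltNge => /negP[].
rewrite (row_linear_sum (f := gform (x, y) ^~ u)); last first.
  by move=> k a b; exact: gform_linear.
rewrite le_eqVlt; apply/orP; left; apply/eqP.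
transitivity (dot (u *m metric_tensor F x y) u); last first.
  by rewrite uM -(scale0r 0) dotZl mul0r.
rewrite /dot.
under [RHS]eq_bigr do rewrite mxE mulr_suml.
rewrite exchange_big; apply: eq_bigr => i _ /=.
rewrite gformC (row_linear_sum (f := gform (x, y) ^~ (e_ i))); last first.
  by move=> k a b; exact: gform_linear.
rewrite mulr_sumr; apply: eq_bigr => j _.
by rewrite metric_tensor_nav// gformC; ring.
Qed.

(** The geodesic coefficients, their vertical differential, and the geodesic
    spray y d/dx - 2 G d/dy as a direction of the product space. *)
Definition geo z : V := (nav z ^+ 2 / 2) *: (wind z *m A) - nav z *: (z.2 *m A).
Definition dgeo z v : V := - dnav z v *: (air z *m A) - nav z *: (v *m A).
Definition spray z : Z := (z.2, -2 *: geo z).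

Section Spray.
Variable z : Z.
Hypothesis phase_z : phase z.

(** The effect of the spray on the time is that of an infinitesimal rotation of
    the air displacement, hence zero: the metric is constant along its
    geodesics. *)
Lemma vert_spray : vert z (spray z) = nav z *: (air z *m A).
Proof.
rewrite /vert /spray /geo /air/= mulmxBl -scalemxAl.
by apply/rowP => i; rewrite !mxE; field.
Qed.

Lemma dnav_spray : dnav z (vert z (spray z)) = 0.
Proof. by rewrite vert_spray /dnav dotZr dotC dot_skew_self// mulr0 mul0r. Qed.

(** Along the spray the air displacement rotates, d air = nav air A, while [nav]
    and [root] are constant. *)
Lemma is_derive_dnav_spray v :
  is_derive z (spray z) (fun z => dnav z v) (- nav z * dnav z (v *m A)).
Proof.
apply: is_derive_eq (is_derive_dnav (spray z) phase_z v) _.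
rewrite dnav_spray scale0r subr0 mulr0 add0r vert_spray.
rewrite [_ + dot _ _](_ : _ = 0); last first.
  rewrite [(spray z).1 *m A](_ : _ = air z *m A + nav z *: (wind z *m A)).
    rewrite dotDr dotZr dotZl !(dot_skew (air z)) dot_skew_self//.
    ring.
  by rewrite /spray/= /air mulmxBl -scalemxAl subrK.
rewrite mulr0 subr0 dotZl /dnav -(opprK (dot (air z *m A) v)) -dot_skew//.
ring.
Qed.

Lemma is_derive_geo w i : is_derive z w (fun z => geo z 0 i)
  ((- dnav z (vert z w) *: (air z *m A) - nav z *: (w.2 *m A)
    + (nav z ^+ 2 / 2) *: (w.1 *m A *m A)) 0 i).
Proof.
rewrite (_ : (fun _ => _) = fun z => nav z ^+ 2 * (wind z *m (2^-1 *: A)) 0 i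
   - nav z * (z.2 *m A) 0 i); last first.
  by apply/funext => y; rewrite -scalemxAr !mxE; ring.
have D1 := is_derive_mul (is_derive_sqr_nav phase_z w)
  (is_derive_mulmx (2^-1 *: A) (is_derive_wind z w) i).
have D2 := is_derive_mul (is_derive_nav w phase_z)
  (is_derive_mulmx A (fun j => is_derive_snd j z w) i).
apply: is_derive_eq (is_derive_sub D1 D2) _.
by rewrite -!scalemxAr /air mulmxBl -!scalemxAl !mxE; field.
Qed.

Lemma is_derive_dgeo_spray v i :
  is_derive z (spray z) (fun z => dgeo z v 0 i)
    ((nav z * dnav z (v *m A)) * (air z *m A) 0 i
     - dnav z v * (nav z * (air z *m A *m A) 0 i)).
Proof.
rewrite (_ : (fun _ => _) = fun z => - 1 * (dnav z v * (air z *m A) 0 i)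
   - nav z * (v *m A) 0 i); last by apply/funext => y; rewrite !mxE; ring.
have D1 := is_derive_mul (is_derive_dnav_spray v)
  (is_derive_mulmx A (is_derive_air (spray z) phase_z) i).
have D2 := is_derive_mul (is_derive_nav (spray z) phase_z)
  (is_derive_cst ((v *m A) 0 i) z (spray z)).
apply: is_derive_eq (is_derive_sub
  (is_derive_mul (is_derive_cst (-1 : R) z (spray z)) D1) D2) _.
rewrite dnav_spray scale0r subr0 vert_spray -scalemxAl !mxE /cst.
ring.
Qed.

Lemma gform_linearr u (k : R) v v' :
  gform z u (k *: v + v') = k * gform z u v + gform z u v'.
Proof. by rewrite gformC gform_linear !(gformC z u). Qed.

(** The equation of geodesics in the form d/dt (dL/dy) = dL/dx for the energy
    L = nav^2 / 2: its left side is the sum of this derivative and of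
    - 2 gform geo v, and its right side is - nav^2 dnav (v A). *)
Lemma Euler_Lagrange v :
  'D_(z.2, 0) (fun z => nav z * dnav z v) z
    = 2 * gform z (geo z) v - nav z ^+ 2 * dnav z (v *m A).
Proof.
have [_ ->] := is_derive_nav_dnav phase_z v (z.2, 0).
rewrite vert_fst/=.
have -> : - (nav z *: (z.2 *m A)) = 2 *: geo z + nav z *: (air z *m A).
  by rewrite -vert_spray /vert /spray/=; apply/rowP => i; rewrite !mxE; ring.
rewrite gform_linear gformZl.
have -> : dot (air z) (z.2 *m A) = - (nav z * dot (air z *m A) (wind z)).
  rewrite dot_skew// -[X in dot _ X]air_add_wind.
  by rewrite dotDr dotZr dot_skew_self// add0r.
have -> : gform z (air z *m A) v = nav z / root z *
    (- (root z * dnav z (v *m A)) - dnav z v * dot (air z *m A) (wind z)).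
  rewrite /gform dnav_air_skew// mul0r add0r subr0 scale0r subr0.
  by rewrite -(dot_airE phase_z) dot_skew// opprK dotDr dotNr dotZr.
by field; exact: root_neq0.
Qed.

(** Euler's relation gform y v = nav dnav v holds with a vector that varies
    with the point of the product space, whereas the components z.2 0 j are
    constants of the differentiation; the two agree along horizontal lines. *)
Lemma gform_contract_snd v a :
  \sum_j z.2 0 j * 'D_(a, 0) (fun z => gform z (e_ j) v) z
    = 'D_(a, 0) (fun z => nav z * dnav z v) z.
Proof.
have Df j : is_derive z (a, 0) (fun z' : Z => z.2 0 j * gform z' (e_ j) v)
    (z.2 0 j * 'D_(a, 0) (fun z => gform z (e_ j) v) z).
  have D := elementary_is_derive (a, 0) (elementary_gform (e_ j) v) phase_z.
  apply: is_derive_eq (is_derive_mul (is_derive_cst (z.2 0 j) z (a, 0)) D) _.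
  by rewrite mul0r add0r.
have [_ <-] := is_derive_sum (index_enum 'I_n) Df.
apply: (derive_eq_along open_phase phase_z) => h pz.
have z2E : z.2 = (h *: (a, 0 : V) + z).2 by rewrite /= scaler0 add0r.
rewrite -gform_snd// -z2E; apply/esym/(@row_linear_sum _ _ (gform _ ^~ v)).
by move=> k b c; exact: gform_linear.
Qed.

Definition dx_momentum a b : R :=
  gform z (- (nav z *: (a *m A))) b
  - nav z / root z * dnav z b * dot (air z) (a *m A).

Lemma derive_fst_nav_dnav a b :
  'D_(a, 0) (fun z => nav z * dnav z b) z = dx_momentum a b.
Proof.
by have [_ ->] := is_derive_nav_dnav phase_z b (a, 0); rewrite vert_fst.
Qed.

Lemma dx_momentum_linearl b (k : R) a a' :
  dx_momentum (k *: a + a') b = k * dx_momentum a b + dx_momentum a' b.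
Proof.
rewrite /dx_momentum -!(scaleNr (nav z)) !gformZl mulmxDl -scalemxAl.
rewrite gform_linear.
by rewrite dotDr dotZr; ring.
Qed.

Lemma dx_momentum_linearr a (k : R) b b' :
  dx_momentum a (k *: b + b') = k * dx_momentum a b + dx_momentum a b'.
Proof. by rewrite /dx_momentum gform_linearr dnav_linear; ring. Qed.

Lemma dx_momentum_snd a :
  dx_momentum a z.2 = - 2 * (nav z ^+ 2 * dnav z (a *m A)).
Proof.
rewrite /dx_momentum gformC gform_snd// dnav_snd// -(scaleNr (nav z)).
rewrite -(addr0 (_ *: _)).
rewrite dnav_linear [dnav z 0](_ : _ = 0).
  by rewrite dot_airE//; field; exact: root_neq0.
by rewrite /dnav -(scale0r 0) dotZr !mul0r.
Qed.

(** Both contractions of the derivatives of the metric tensor become derivatives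
    of the momentum, and [Euler_Lagrange] evaluates them. *)
Lemma geodesic_contraction l :
  \sum_j \sum_k (2 * 'D_(e_ k, 0) (fun z => gform z (e_ j) (e_ l)) z
     - 'D_(e_ l, 0) (fun z => gform z (e_ j) (e_ k)) z) * z.2 0 j * z.2 0 k
  = 4 * gform z (geo z) (e_ l).
Proof.
rewrite exchange_big/=.
transitivity (\sum_k z.2 0 k * (2 * dx_momentum (e_ k) (e_ l)
                                 - dx_momentum (e_ l) (e_ k))).
  apply: eq_bigr => k _; rewrite -!derive_fst_nav_dnav -!gform_contract_snd.
  rewrite !mulr_sumr -sumrB mulr_sumr; apply: eq_bigr => j _; ring.
under eq_bigr do rewrite mulrBr mulrCA.
rewrite sumrB -mulr_sumr.
rewrite -(row_linear_sum (f := dx_momentum ^~ (e_ l))); last first.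
  by move=> k a b; exact: dx_momentum_linearl.
rewrite -(row_linear_sum (f := dx_momentum (e_ l))); last first.
  by move=> k a b; exact: dx_momentum_linearr.
rewrite dx_momentum_snd -derive_fst_nav_dnav Euler_Lagrange; ring.
Qed.

End Spray.

(** The sum of [geodesic_contraction] is the value at [geo] of the lowering of
    indices, which the inverse metric tensor undoes. *)
Lemma geodesic_coef_nav i x y : phase (x, y) ->
  geodesic_coef F i x y = geo (x, y) 0 i.
Proof.
move=> pz; rewrite /geodesic_coef.
set M := metric_tensor F x y; set g := geo (x, y).
have dgE (a : V) j k : 'D_a (fun x' => metric_tensor F x' y j k) x =
    'D_(a, 0) (fun z => gform z (e_ j) (e_ k)) (x, y).
  rewrite (derive_fst (fun x y => metric_tensor F x y j k)).
  apply: (derive_eq_on open_phase) => // -[x' y'] pz' /=.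
  exact: metric_tensor_nav.
have gM l : (M *m g^T) l 0 = gform (x, y) g (e_ l).
  rewrite mxE (row_linear_sum (f := gform (x, y) ^~ (e_ l))); last first.
    by move=> k a b; exact: gform_linear.
  by apply: eq_bigr => j _; rewrite metric_tensor_nav// gformC mulrC mxE.
transitivity (4^-1 * (\sum_l invmx M i l * (4 * (M *m g^T) l 0))).
  congr (_ * _); apply: eq_bigr => l _.
  rewrite gM -(geodesic_contraction pz) mulr_sumr; apply: eq_bigr => j _.
  rewrite mulr_sumr; apply: eq_bigr => k _.
  by rewrite /partial_x !dgE/= !mulrA.
under eq_bigr do rewrite mulrCA; rewrite -mulr_sumr mulKf ?pnatr_eq0//.
transitivity ((invmx M *m (M *m g^T)) i 0); first by rewrite [RHS]mxE.
by rewrite mulKmx ?metric_tensor_unit// mxE.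
Qed.

Lemma partial_y_geo x y k i : phase (x, y) ->
  partial_y k (geodesic_coef F i) x y = dgeo (x, y) (e_ k) 0 i.
Proof.
move=> pz; rewrite /partial_y derive_snd.
rewrite (@derive_eq_on _ _ _ open_phase _ (fun z => geo z 0 i))//; last first.
  by case=> x' y' pz'; exact: geodesic_coef_nav.
have [_ ->] := is_derive_geo pz (0, e_ k) i.
by rewrite vert_snd !mul0mx scaler0 addr0.
Qed.

Lemma partial_x_geo x y k i : phase (x, y) ->
  partial_x k (geodesic_coef F i) x y =
  (nav (x, y) * dnav (x, y) (e_ k *m A)) * (air (x, y) *m A) 0 i
  + nav (x, y) ^+ 2 / 2 * (e_ k *m A *m A) 0 i.
Proof.
move=> pz; rewrite /partial_x (derive_fst (geodesic_coef F i)).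
rewrite (@derive_eq_on _ _ _ open_phase _ (fun z => geo z 0 i))//; last first.
  by case=> x' y' pz'; exact: geodesic_coef_nav.
have [_ ->] := is_derive_geo pz (e_ k, 0) i.
rewrite vert_fst mul0mx scaler0 subr0 -(scaleNr (nav (x, y))).
by rewrite [dnav _ (_ *: _)]/dnav dotZr -mulrA -/(dnav _ _) !mxE; ring.
Qed.

Lemma elementary_dgeo v i : elementary phase (fun z => dgeo z v 0 i).
Proof.
rewrite (_ : (fun _ => _) = fun z => - 1 * (dnav z v * (air z *m A) 0 i)
   - nav z * (v *m A) 0 i); last by apply/funext => y; rewrite !mxE; ring.
apply: elementary_sub; apply: elementary_mul.
- exact: elementary_cst.
- apply: elementary_mul; first exact: elementary_dnav.
  by apply: elementary_mulmx => j; exact: elementary_air.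
- exact: elementary_nav.
- exact: elementary_cst.
Qed.

Lemma dgeo_linear z (k : R) u v :
  dgeo z (k *: u + v) = k *: dgeo z u + dgeo z v.
Proof.
rewrite /dgeo dnav_linear (mulmxDl (k *: u)) -scalemxAl.
by apply/rowP => i; rewrite !mxE; ring.
Qed.

(** The term quadratic in the differential of [air] drops out because
    dnav (air A) = 0. *)
Lemma dgeo_dgeo z v i : phase z -> dgeo z (dgeo z v) 0 i =
  nav z * dnav z (v *m A) * (air z *m A) 0 i
  + nav z * dnav z v * (air z *m A *m A) 0 i
  + nav z ^+ 2 * (v *m A *m A) 0 i.
Proof.
move=> pz; rewrite {1}/dgeo.
have -> : dnav z (dgeo z v) = - (nav z * dnav z (v *m A)).
  rewrite /dgeo dnav_linear dnav_air_skew// mulr0 add0r -(scaleNr (nav z)).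
  by rewrite /dnav dotZr -mulrA mulNr.
rewrite /dgeo (mulmxBl (- dnav z v *: _)) -!scalemxAl.
by rewrite !mxE; ring.
Qed.

Lemma derive_spray z f : phase z -> elementary phase f ->
  \sum_j z.2 0 j * 'D_(e_ j, 0) f z - 2 * \sum_j geo z 0 j * 'D_(0, e_ j) f z
  = 'D_(spray z) f z.
Proof.
move=> pz ef.
have Dx : 'D_(z.2, 0) f z = \sum_j z.2 0 j * 'D_(e_ j, 0) f z.
  apply: (@row_linear_sum _ _ (fun a => 'D_(a, 0) f z)) => k a b.
  rewrite -(elementary_derive_linear _ _ _ ef pz).
  by congr ('D_ _ _ _); rewrite [RHS]surjective_pairing/= scaler0 addr0.
have Dy : 'D_(0, geo z) f z = \sum_j geo z 0 j * 'D_(0, e_ j) f z.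
  apply: (@row_linear_sum _ _ (fun a => 'D_(0, a) f z)) => k a b.
  rewrite -(elementary_derive_linear _ _ _ ef pz).
  by congr ('D_ _ _ _); rewrite [RHS]surjective_pairing/= scaler0 addr0.
have Dw : 'D_(spray z) f z = -2 * 'D_(0, geo z) f z + 'D_(z.2, 0) f z.
  rewrite -(elementary_derive_linear _ _ _ ef pz).
  by congr ('D_ _ _ _); rewrite [RHS]surjective_pairing/= scaler0 add0r addr0.
by apply/esym; rewrite Dw Dx Dy addrC mulNr.
Qed.

(** The two sums with second derivatives form minus the derivative of [dgeo]
    along the spray.  With l = dnav and N = nav, the terms are, applied to v,
    2 N l(v A) air A + N^2 v A^2 from the derivative in x,
    - N l(v A) air A + N l(v) air A^2 from the spray, and
    - N l(v A) air A - N l(v) air A^2 - N^2 v A^2 from the square of [dgeo]. *)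
Lemma riemann_coef_nav i k x y : phase (x, y) -> riemann_coef F i k x y = 0.
Proof.
move=> pz.
have D (v : Z) :
    'D_v (fun z => partial_y k (geodesic_coef F i) z.1 z.2) (x, y) =
    'D_v (fun z => dgeo z (e_ k) 0 i) (x, y).
  apply: (derive_eq_on open_phase) => // -[x' y'] pz'.
  exact: partial_y_geo.
have Dx j : partial_x j (partial_y k (geodesic_coef F i)) x y =
    'D_(e_ j, 0) (fun z => dgeo z (e_ k) 0 i) (x, y).
  by rewrite /partial_x (derive_fst (partial_y k (geodesic_coef F i))) D.
have Dy j : partial_y j (partial_y k (geodesic_coef F i)) x y =
    'D_(0, e_ j) (fun z => dgeo z (e_ k) 0 i) (x, y).
  by rewrite [LHS](derive_snd (partial_y k (geodesic_coef F i))) D.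
have S := derive_spray pz (elementary_dgeo (e_ k) i).
have [_ dS] := is_derive_dgeo_spray pz (e_ k) i; rewrite dS/= in S.
have E1 : \sum_j y 0 j * partial_x j (partial_y k (geodesic_coef F i)) x y =
    \sum_j y 0 j * 'D_(e_ j, 0) (fun z => dgeo z (e_ k) 0 i) (x, y).
  by apply: eq_bigr => j _; rewrite Dx.
have E2 : \sum_j geodesic_coef F j x y *
      partial_y j (partial_y k (geodesic_coef F i)) x y =
    \sum_j geo (x, y) 0 j * 'D_(0, e_ j) (fun z => dgeo z (e_ k) 0 i) (x, y).
  by apply: eq_bigr => j _; rewrite Dy geodesic_coef_nav.
have E3 : \sum_j partial_y j (geodesic_coef F i) x y *
      partial_y k (geodesic_coef F j) x y =
    dgeo (x, y) (dgeo (x, y) (e_ k)) 0 i.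
  rewrite (@row_linear_sum _ _ (fun v => dgeo (x, y) v 0 i)); last first.
    by move=> c a b; rewrite dgeo_linear !mxE.
  by apply: eq_bigr => j _; rewrite !partial_y_geo// mulrC.
apply: (curvature_combination (partial_x_geo k i pz) E1 E2
  (etrans E3 (dgeo_dgeo (e_ k) i pz)) S).
by field.
Qed.

Lemma riemann_curvature_nav x y u : phase (x, y) ->
  riemann_curvature F x y u = 0.
Proof.
move=> pz; apply/rowP => i; rewrite !mxE big1// => k _.
by rewrite riemann_coef_nav// mul0r.
Qed.

Lemma flag_curvature_nav x y u : phase (x, y) -> flag_curvature F x y u = 0.
Proof.
move=> pz; rewrite /flag_curvature riemann_curvature_nav//.
by rewrite fundamental_form_nav// -(scale0r 0) gformZl !mul0r.
Qed.

Lemma divergence_geo x y : phase (x, y) ->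
  \sum_i partial_y i (geodesic_coef F i) x y = 0.
Proof.
move=> pz.
transitivity (- (\sum_i (air (x, y) *m A) 0 i * dnav (x, y) (e_ i))
    - nav (x, y) * \tr A).
  rewrite mulr_sumr -sumrN -sumrB; apply: eq_bigr => i _.
  rewrite partial_y_geo// /dgeo /coord_vec -rowE [in LHS]mxE [in LHS]mxE.
  rewrite [in X in _ + X]mxE [in X in _ + X]mxE [row _ _ _ _]mxE.
  by rewrite mulNr mulrC.
rewrite -(@row_linear_sum _ _ (dnav (x, y))); last first.
  by move=> k a b; exact: dnav_linear.
have trA : \tr A = 0.
  have := mxtrace_tr A; rewrite skewA linearN/=; lra.
by rewrite dnav_air_skew// trA mulr0 subr0 oppr0.
Qed.

(** By [nav_lt1] the unit ball of the metric at [x] is the Euclidean one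
    translated by the wind. *)
Lemma volume_unit_ball x : calm x ->
  volume [set y | F x y < 1] = volume [set y : V | enorm y < 1].
Proof.
move=> cx; rewrite -[RHS](volume_translate (x *m A)); congr volume.
apply/funext => y /=; rewrite /nav_metric nav_lt1// /wind/=.
by rewrite /enorm -[in RHS]sqrtr1 ltr_sqrt.
Qed.

(** The density is the same quotient at all points of the domain, whatever its
    value may be. *)
Lemma derive_ln_sigma_BH x v : calm x ->
  'D_v (fun x' => ln (sigma_BH F x')) x = 0.
Proof.
move=> cx; set b := fine (volume [set y : V | enorm y < 1]).
rewrite (@derive_eq_on _ _ _ open_calm _ (cst (ln (b / b))))//.
  exact: derive_cst.
by move=> x' cx'; rewrite /sigma_BH volume_unit_ball.
Qed.

Lemma S_curvature_nav x y : phase (x, y) -> S_curvature F x y = 0.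
Proof.
move=> pz; rewrite /S_curvature divergence_geo// big1 ?subr0// => i _.
by rewrite derive_ln_sigma_BH ?mulr0//; case: pz.
Qed.

End Navigation.

(** * The fish tank *)

Section FishTank.
Variables (R : realType) (n : nat) (n_ge2 : (2 <= n)%N).
Let i1 : 'I_n := Ordinal (ltnW n_ge2).
Let i2 : 'I_n := Ordinal n_ge2.
Local Notation e_ i := (coord_vec R i).

(** The wind of this matrix at x is (- x_2, x_1, 0, ..., 0). *)
Definition rotation : 'M[R]_n := delta_mx i1 i2 - delta_mx i2 i1.

Lemma rotation_skew : rotation^T = - rotation.
Proof. by rewrite /rotation linearB/= !trmx_delta opprB. Qed.

Lemma mul_rotation x : x *m rotation = x 0 i1 *: e_ i2 - x 0 i2 *: e_ i1.
Proof.
have E i j : x *m delta_mx i j = x 0 i *: e_ j.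
  apply/rowP => k; rewrite !mxE (bigD1 i)//= big1 => [|l li].
    by rewrite mxE eqxx addr0.
  by rewrite mxE (negbTE li) mulr0.
by rewrite /rotation mulmxBr !E.
Qed.

Lemma dot_rotation x w : dot (x *m rotation) w =
  - coord2 n_ge2 x * coord1 n_ge2 w + coord1 n_ge2 x * coord2 n_ge2 w.
Proof.
by rewrite mul_rotation !dotE ![dot (e_ _) _]dotC !dot_coord mulNr addrC.
Qed.

Lemma dot_rotation_self x : dot (x *m rotation) (x *m rotation) =
  coord1 n_ge2 x ^+ 2 + coord2 n_ge2 x ^+ 2.
Proof.
by rewrite dot_rotation /coord1 /coord2 mul_rotation !mxE /=; ring.
Qed.

Lemma fish_tank_calm : fish_tank n_ge2 = calm rotation.
Proof. by apply/funext => x; rewrite /calm/= dot_rotation_self. Qed.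

Lemma enorm_sqr (w : 'rV[R]_n) : enorm w ^+ 2 = dot w w.
Proof.
rewrite sqr_sqrtr; first by apply: eq_bigr => i _; rewrite expr2.
by apply: sumr_ge0 => i _; exact: sqr_ge0.
Qed.

Lemma fish_tank_metric_nav : fish_tank_metric n_ge2 = nav_metric rotation.
Proof.
apply/funext => x; apply/funext => w.
rewrite /fish_tank_metric enorm_sqr -dot_rotation.
rewrite /nav_metric /nav /root /drift /slack /wind/=.
by rewrite dot_rotation_self opprD addrA.
Qed.

End FishTank.

Theorem theorem1p1 (R : realType) (n : nat) (n_ge2 : (2 <= n)%N) :
  let Omega : set 'rV[R]_n := fish_tank n_ge2 in
  let F : 'rV[R]_n -> 'rV[R]_n -> R := fish_tank_metric n_ge2 in
  [/\ finsler_metric Omega F,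
      forall (p : 'rV[R]_n) (P : {vspace 'rV[R]_n}) (y u : 'rV[R]_n),
        Omega p -> \dim P = 2%N -> y \in P -> y != 0 ->
        P = <<[:: y; u]>>%VS -> flag_curvature F p y u = 0
    & forall p y : 'rV[R]_n, Omega p -> y != 0 -> S_curvature F p y = 0].
Proof.
rewrite /= fish_tank_calm fish_tank_metric_nav.
have skew := rotation_skew R n_ge2.
have phaseE p y : calm (rotation R n_ge2) p -> y != 0 ->
    phase (rotation R n_ge2) (p, y) by move=> cp y0; split=> //; exact/eqP.
split; first exact: finsler_nav.
  by move=> p P y u cp _ _ y0 _; apply: flag_curvature_nav => //; exact: phaseE.
by move=> p y cp y0; apply: S_curvature_nav => //; exact: phaseE.
Qed.
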